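(* For every integer $k\ge1$, let $C_k(q)$ be the $k$-th crank moment generating function and $\mathcal{C}_k(q)=(q)_\infty C_k(q)$. Then for every integer $k\ge1$, $$\mathcal{C}_{2k}(q)=\mathrm{Tr}_k\left(\phi_M;\,G_2+\frac{B_2}{4},\,G_4+\frac{B_4}{8},\,\ldots,\,G_{2k}+\frac{B_{2k}}{4k}\right)$$ and $$G_{2k}(\tau)=-\frac{B_{2k}}{4k}+\mathrm{Tr}_k\left(\phi_S;\,\mathcal{C}_2(q),\mathcal{C}_4(q),\ldots,\mathcal{C}_{2k}(q)\right).$$
   Context: Here $q=e^{2\pi i\tau}$ with $\mathrm{Im}(\tau)>0$, $(a)_\infty=\prod_{j\ge1}(1-aq^{j-1})$, in particular $(q)_\infty=\prod_{j\ge1}(1-q^j)$. The crank generating function is $$C(\zeta;q)=\sum_{m\in\mathbb{Z},\,n\ge0}M(m,n)\zeta^mq^n=\frac{(q)_\infty}{(\zeta q)_\infty(\zeta^{-1}q)_\infty},$$ where the crank counts $M(m,n)$ are the coefficients defined by this identity, and $$C_k(q)=\sum_{n\ge0}\sum_{m\in\mathbb{Z}}m^kM(m,n)q^n=\left.\left(\zeta\frac{d}{d\zeta}\right)^kC(\zeta;q)\right|_{\zeta=1}.$$ $B_n$ is the $n$-th Bernoulli number, $\sigma_j(n)=\sum_{d\mid n}d^j$, and $G_{2k}(\tau)=-\frac{B_{2k}}{4k}+\sum_{n\ge1}\sigma_{2k-1}(n)q^n$. A partition $\lambda\vdash k$ is written $\lambda=(1^{m_1},\ldots,k^{m_k})$,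 with $m_j\ge0$ the multiplicity of the part $j$ and $\sum_jjm_j=k$; $\ell(\lambda)=m_1+\cdots+m_k$. For a function $\phi$ on partitions, $\mathrm{Tr}_k(\phi;X_1,\ldots,X_k)=\sum_{\lambda\vdash k}\phi(\lambda)\prod_{j=1}^kX_j^{m_j}$. For $\lambda\vdash k$, $$\phi_M(\lambda)=(2k)!\prod_{j=1}^k\frac{2^{m_j}}{m_j!\,((2j)!)^{m_j}},\qquad \phi_S(\lambda)=\frac{(2k)!}{2}(-1)^{\ell(\lambda)-1}(\ell(\lambda)-1)!\prod_{j=1}^k\frac{1}{m_j!\,((2j)!)^{m_j}}.$$ *)

(* Defs.v *)
From mathcomp Require Import all_boot all_order all_algebra.
From mathcomp Require Import all_classical all_reals all_analysis.
From mathcomp Require Export complex.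
Set Implicit Arguments.
Unset Strict Implicit.
Unset Printing Implicit Defensive.
Import Order.TTheory GRing.Theory Num.Theory.
Import numFieldNormedType.Exports.
Local Open Scope ring_scope.
Local Open Scope classical_set_scope.
Local Open Scope complex_scope.

(* Elements of Z[z, z^-1][[q]]: [F m n] is the coefficient of z^m q^n. *)
Definition qlaurent := int -> nat -> int.

Definition qlaurent1 : qlaurent := fun m n => ((m == 0) && (n == 0%N))%:R.

(* (1 - z^e q^j) F *)
Definition mul_factor (e : int) (j : nat) (F : qlaurent) : qlaurent :=
  fun m n => F m n - (if (j <= n)%N then F (m - e) (n - j)%N else 0).

(* F / (1 - z^e q^j) = \sum_(r >= 0) z^(e r) q^(j r) F, meaningful for j > 0;
   only the r with j r <= n contribute to the coefficient of q^n. *)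
Definition div_factor (e : int) (j : nat) (F : qlaurent) : qlaurent :=
  fun m n => \sum_(r < (n %/ j).+1) F (m - e * r%:Z) (n - r * j)%N.

Lemma div_factorK (e : int) (j : nat) (F : qlaurent) (m : int) (n : nat) :
  (0 < j)%N -> mul_factor e j (div_factor e j F) m n = F m n.
Proof.
move=> j0; rewrite /mul_factor /div_factor big_ord_recl /= mulr0 subr0 mul0n subn0.
case: leqP => [jn|nj]; last by rewrite divn_small // big_ord0 addr0 subr0.
have -> : (n %/ j = ((n - j) %/ j).+1)%N.
  by rewrite -{1}(subnK jn) divnDr // divnn j0 addn1.
rewrite -[RHS]addr0 -addrA; congr (_ + _); apply/eqP; rewrite subr_eq0.
apply/eqP; apply: eq_bigr => r _; rewrite /bump /= add1n; congr F; last first.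
  by rewrite mulSn subnDA.
by rewrite -addn1 PoszD mulrDr mulr1 opprD [- _ - e]addrC addrA.
Qed.

(* \prod_(1 <= j <= N) (1 - q^j) / ((1 - z q^j) (1 - z^-1 q^j)) *)
Fixpoint crank_prod (N : nat) : qlaurent :=
  if N is N'.+1 then
    div_factor 1 N (div_factor (-1) N (mul_factor 0 N (crank_prod N')))
  else qlaurent1.

(* The coefficient of z^m q^n in (q)_oo / ((z q)_oo (z^-1 q)_oo); the factors
   with j > n are 1 modulo q^(n+1), see [crank_prodE]. *)
Definition crankM (m : int) (n : nat) : int := crank_prod n m n.

Lemma crank_prodE (N : nat) (m : int) (n : nat) :
  (n <= N)%N -> crank_prod N m n = crankM m n.
Proof.
move=> /subnK <-; elim: (N - n)%N => [//|d IH]; rewrite addSn /= -IH.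
have lt : (n < (d + n).+1)%N by rewrite ltnS leq_addl.
rewrite /div_factor !divn_small // !big_ord1 /= !mulr0 !subr0 !mul0n !subn0.
by rewrite divn_small // big_ord1 /= mulr0 subr0 mul0n subn0 /mul_factor leqNgt lt subr0.
Qed.

(* Bernoulli numbers, B_1 = -1/2:
   \sum_(j <= n) 'C(n+1, j) B_j = 0 for n > 0, and B_0 = 1. *)
Fixpoint bernoulli_seq (n : nat) : seq rat :=
  if n is n'.+1 then
    let s := bernoulli_seq n' in
    rcons s ((n == 1%N)%:R - (\sum_(j < n') 'C(n, j)%:R * s`_j) / n%:R)
  else [::].

Definition bernoulli (n : nat) : rat := (bernoulli_seq n.+1)`_n.

Definition sigma (j n : nat) : nat := \sum_(d <- divisors n) d ^ j.

(* A partition (1^m_1, ..., k^m_k) of k, as the function i |-> m_(i+1). *)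
Definition is_partition (k : nat) (m : {ffun 'I_k -> 'I_k.+1}) : bool :=
  (\sum_(i < k) i.+1 * m i == k)%N.

Definition part_length (k : nat) (m : {ffun 'I_k -> 'I_k.+1}) : nat :=
  \sum_(i < k) m i.

(* Only X 1, ..., X k are used. *)
Definition partition_trace (K : fieldType) (k : nat)
    (phi : {ffun 'I_k -> 'I_k.+1} -> K) (X : nat -> K) : K :=
  \sum_(m : {ffun 'I_k -> 'I_k.+1} | is_partition m)
    phi m * \prod_(i < k) X i.+1 ^+ m i.

Definition phi_M (K : fieldType) (k : nat) (m : {ffun 'I_k -> 'I_k.+1}) : K :=
  (2 * k)`!%:R *
  \prod_(i < k) (2 ^+ m i / ((m i)`!%:R * (2 * i.+1)`!%:R ^+ m i)).

Definition phi_S (K : fieldType) (k : nat) (m : {ffun 'I_k -> 'I_k.+1}) : K :=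
  (2 * k)`!%:R / 2 * (-1) ^+ (part_length m).-1 * (part_length m).-1`!%:R *
  \prod_(i < k) ((m i)`!%:R * (2 * i.+1)`!%:R ^+ m i)^-1.

(* R[i]^o is R[i] with the topology given by its modulus. *)
Definition csum (R : realType) (u : nat -> R[i]) : R[i] :=
  lim ((fun N => \sum_(0 <= n < N) u n : R[i]^o) @ \oo).

Definition cprod (R : realType) (u : nat -> R[i]) : R[i] :=
  lim ((fun N => \prod_(0 <= n < N) u n : R[i]^o) @ \oo).

Definition cexp (R : realType) (z : R[i]) : R[i] :=
  (expR (complex.Re z))%:C * (cos (complex.Im z) +i* sin (complex.Im z)).

Definition nome (R : realType) (tau : R[i]) : R[i] := cexp (2 * pi%:C * 'i%C * tau).

(* (a)_oo *)
Definition qpoch (R : realType) (a q : R[i]) : R[i] := cprod (fun j => 1 - a * q ^+ j).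

(* The inner sum ranges over all of Z and has finite support. *)
Definition crank_moment (R : realType) (k : nat) (q : R[i]) : R[i] :=
  csum (fun n => (\sum_(m \in [set: int]) m ^+ k * crankM m n)%:~R * q ^+ n).

Definition norm_crank_moment (R : realType) (k : nat) (q : R[i]) : R[i] :=
  qpoch q q * crank_moment k q.

(* G_k, for even k; -B_k/(2k) is -B_(2j)/(4j) when k = 2j. *)
Definition eisenstein (R : realType) (k : nat) (tau : R[i]) : R[i] :=
  - ratr (bernoulli k) / (2 * k)%:R
  + csum (fun n => (sigma k.-1 n.+1)%:R * nome tau ^+ n.+1).

(* Main.v *)
Require Import Defs.
From mathcomp Require Import all_boot all_order all_algebra.
From mathcomp Require Import all_classical all_reals all_analysis.
From mathcomp Require Import zify ring lra.
Set Implicit Arguments.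
Unset Strict Implicit.
Unset Printing Implicit Defensive.
Import Order.TTheory GRing.Theory Num.Theory.
Local Open Scope ring_scope.
Local Open Scope complex_scope.

(* Logarithmic differentiation of the crank generating function C in zeta gives
     zeta dC/dzeta = C * sum_(j, r >= 1) (zeta^r - zeta^(-r)) q^(j r).
   Applying (zeta d/dzeta)^(2K+1) at zeta = 1 yields the recurrence
     C_(2K+2) = 2 sum_(t <= K) 'C(2K+1, 2t+1) S_(2t+2) C_(2(K-t)),
   where S_(2j) = sum_n sigma_(2j-1)(n) q^n = G_(2j) + B_(2j)/(4j).  Since
   (q)_oo C_0 = 1, the normalized moments satisfy the same recurrence with initial
   value 1, that is, with a(z) = sum_j (q)_oo C_(2j) z^j / (2j)! and
   y(z) = sum_(j >= 1) 2 S_(2j) z^j / (2j)!, we have a' = y' a and a(0) = 1.  So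
   a = exp y and y = log a, and by the multinomial theorem the two traces are the
   coefficients of exp y and log a. *)

(** * The crank product *)

(** The crank product is formal while (q)_oo and the moments are limits, so every identity is proved
    on integer coefficients before it is summed against q^n. The delicate limit is (q)_oo C_0 = 1:
    at zeta = 1 the product truncated at N has coefficients [npart N n], nonnegative, nondecreasing
    in N and equal to [moment 0 n] for N >= n, and this monotonicity controls the tails. Absolute
    convergence of the higher moments comes from the recurrence itself, which makes each of them a
    finite combination of Cauchy products of divisor series and lower moments. Only even moments
    occur because (m + r)^(2K+1) - (m - r)^(2K+1) contains only odd powers of r, hence even powers
    of m. The exponential and the logarithm are polynomials truncated at degree k; in their
    differential equations the truncation error has valuation at least k, so it does not touch the
    coefficients that are compared. *)

Definition qshift (e : int) (j : nat) (F : qlaurent) : qlaurent :=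
  fun m n => if (j <= n)%N then F (m - e) (n - j)%N else 0.

Lemma qshiftD (e e' : int) (j j' : nat) (F : qlaurent) :
  qshift e j (qshift e' j' F) = qshift (e + e') (j + j') F.
Proof.
apply: funext => m; apply: funext => n; rewrite /qshift.
case: (leqP j n) => jn; last by case: leqP => //; lia.
rewrite leq_subRL // subnDA; case: ifP => // _; congr F; lia.
Qed.

(** Here [qshift e j] is multiplication by z^e q^j, zero on coefficients with n < j, so the
    geometric series may be cut at any B > n. A range independent of n allows sums to be
    exchanged. *)
Lemma div_factor_qshiftE (B : nat) (e : int) (j : nat) (F : qlaurent) (m : int) (n : nat) :
  (0 < j)%N -> (n < B)%N ->
  div_factor e j F m n = \sum_(r < B) qshift (e * r%:Z) (r * j) F m n.
Proof.
move=> j0 nB; rewrite /div_factor /qshift.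
rewrite (big_ord_widen_cond B xpredT (fun r => F (m - e * r%:Z) (n - r * j)%N)); last first.
  by rewrite (leq_ltn_trans (leq_div _ _)).
by rewrite big_mkcond /=; apply: eq_bigr => r _; rewrite ltnS leq_divRL.
Qed.

Lemma qshift_sum (e : int) (j : nat) (I : Type) (s : seq I) (F : I -> qlaurent)
    (m : int) (n : nat) :
  qshift e j (fun m n => \sum_(i <- s) F i m n) m n = \sum_(i <- s) qshift e j (F i) m n.
Proof. by rewrite /qshift; case: ifP => // _; rewrite big1. Qed.

Lemma qshift_local (e : int) (j : nat) (F G : qlaurent) (m : int) (n : nat) :
  (forall m' n', (n' <= n)%N -> F m' n' = G m' n') -> qshift e j F m n = qshift e j G m n.
Proof. by move=> FG; rewrite /qshift; case: ifP => // _; rewrite FG ?leq_subr. Qed.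

Lemma div_factor_qshift (e e' : int) (j j' : nat) (F : qlaurent) : (0 < j)%N ->
  div_factor e j (qshift e' j' F) = qshift e' j' (div_factor e j F).
Proof.
move=> j0; apply: funext => m; apply: funext => n.
rewrite (div_factor_qshiftE (B := n.+1)) //.
rewrite (@qshift_local _ _ _ (fun m n' =>
  \sum_(r < n.+1) qshift (e * r%:Z) (r * j) F m n')); last first.
  by move=> m' n' n'n; apply: div_factor_qshiftE.
by rewrite qshift_sum; apply: eq_bigr => r _; rewrite !qshiftD addrC addnC.
Qed.

Lemma div_factorB (e : int) (j : nat) (F G : qlaurent) :
  div_factor e j (fun m n => F m n - G m n) =
  (fun m n => div_factor e j F m n - div_factor e j G m n).
Proof. by apply: funext => m; apply: funext => n; rewrite /div_factor sumrB. Qed.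

Lemma div_factor_mul (e e' : int) (j j' : nat) (F : qlaurent) : (0 < j)%N ->
  div_factor e j (mul_factor e' j' F) = mul_factor e' j' (div_factor e j F).
Proof.
by move=> j0; rewrite [LHS]div_factorB (div_factor_qshift e e' j' F j0).
Qed.

Lemma mul_div_factor (e : int) (j : nat) (F : qlaurent) : (0 < j)%N ->
  mul_factor e j (div_factor e j F) = F.
Proof. by move=> j0; apply: funext => m; apply: funext => n; apply: div_factorK. Qed.

Lemma div_mul_factor (e : int) (j : nat) (F : qlaurent) : (0 < j)%N ->
  div_factor e j (mul_factor e j F) = F.
Proof. by move=> j0; rewrite div_factor_mul // mul_div_factor. Qed.

(** Inverses of commuting operators commute: [mul_factor e j] commutes with division by the other
    factor and is inverted by [div_factor e j] on both sides. *)
Lemma div_factorC (e e' : int) (j j' : nat) (F : qlaurent) : (0 < j)%N -> (0 < j')%N ->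
  div_factor e j (div_factor e' j' F) = div_factor e' j' (div_factor e j F).
Proof.
move=> j0 j'0; rewrite -[RHS](div_mul_factor e _ j0); congr div_factor.
by rewrite -div_factor_mul // mul_div_factor.
Qed.

(** With x = z^e q^j, this is x / (1 - x) = 1 / (1 - x) - 1. *)
Lemma qshift_div_factor (e : int) (j : nat) (F : qlaurent) (m : int) (n : nat) : (0 < j)%N ->
  qshift e j (div_factor e j F) m n = div_factor e j F m n - F m n.
Proof. by move=> j0; rewrite -[in X in _ - X](mul_div_factor e F j0) opprB addrC subrK. Qed.

Lemma div_factor_sum (e : int) (j : nat) (I : Type) (s : seq I) (F : I -> qlaurent) :
  div_factor e j (fun m n => \sum_(i <- s) F i m n) =
  (fun m n => \sum_(i <- s) div_factor e j (F i) m n).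
Proof. by apply: funext => m; apply: funext => n; rewrite /div_factor exchange_big. Qed.

Lemma mul_factor_sum (e : int) (j : nat) (I : Type) (s : seq I) (F : I -> qlaurent) :
  mul_factor e j (fun m n => \sum_(i <- s) F i m n) =
  (fun m n => \sum_(i <- s) mul_factor e j (F i) m n).
Proof.
apply: funext => m; apply: funext => n; rewrite sumrB; congr (_ - _).
exact: qshift_sum.
Qed.

Lemma mul_factorB (e : int) (j : nat) (F G : qlaurent) :
  mul_factor e j (fun m n => F m n - G m n) =
  (fun m n => mul_factor e j F m n - mul_factor e j G m n).
Proof.
apply: funext => m; apply: funext => n; rewrite /mul_factor.
by case: ifP => _; ring.
Qed.

(* zeta d/dzeta *)
Definition zderiv (F : qlaurent) : qlaurent := fun m n => m * F m n.

Lemma zderiv_mul0 (j : nat) (F : qlaurent) :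
  zderiv (mul_factor 0 j F) = mul_factor 0 j (zderiv F).
Proof.
apply: funext => m; apply: funext => n; rewrite /zderiv /mul_factor subr0 mulrBr.
by case: ifP => // _; rewrite mulr0.
Qed.

(** Quotient rule: with x = z^e q^j, the derivation D = z d/dz has D x = e x, so (1 - x) D G = D F +
    e x G; divide by 1 - x and use x / (1 - x) = 1 / (1 - x) - 1. *)
Lemma zderiv_div (e : int) (j : nat) (F : qlaurent) (m : int) (n : nat) : (0 < j)%N ->
  let G := div_factor e j F in
  zderiv G m n = div_factor e j (zderiv F) m n + e * (div_factor e j G m n - G m n).
Proof.
move=> j0 G; rewrite -qshift_div_factor // -div_factor_qshift //.
suff -> : zderiv G = div_factor e j (fun m n => zderiv F m n - (- e) * qshift e j G m n).
  by rewrite div_factorB /div_factor -mulr_sumr mulNr opprK.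
rewrite -[LHS](div_mul_factor e _ j0); congr div_factor.
apply: funext => {}m; apply: funext => {}n.
have -> : F = mul_factor e j G by rewrite mul_div_factor.
rewrite /zderiv /mul_factor /qshift; case: ifP => _; move: (G m n) (G _ _) => x y; ring.
Qed.

(** Logarithmic derivative of the finite product. The numerators 1 - q^j are free of z, and the pair
    of denominators contributes z q^j / (1 - z q^j) - z^-1 q^j / (1 - z^-1 q^j), which equals 1 / (1
    - z q^j) - 1 / (1 - z^-1 q^j) because the constants cancel. *)
Lemma zderiv_crank_prod (N : nat) (m : int) (n : nat) :
  zderiv (crank_prod N) m n =
  \sum_(j < N) (div_factor 1 j.+1 (crank_prod N) m n - div_factor (-1) j.+1 (crank_prod N) m n).
Proof.
elim: N m n => [|N IH] m n.
  by rewrite big_ord0 /zderiv /= /qlaurent1; case: eqP => [->|_] /=; rewrite (mul0r, mulr0).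
have {}IH : zderiv (crank_prod N) = (fun m n => \sum_(j < N)
  (div_factor 1 j.+1 (crank_prod N) m n - div_factor (-1) j.+1 (crank_prod N) m n)).
  by apply: funext => ?; apply: funext => ?; apply: IH.
rewrite big_ord_recr [crank_prod N.+1]/=.
have crank_div e j : div_factor 1 N.+1 (div_factor (-1) N.+1
    (mul_factor 0 N.+1 (div_factor e j.+1 (crank_prod N)))) =
    div_factor e j.+1 (crank_prod N.+1).
  by rewrite /= -div_factor_mul // [div_factor (-1) _ (div_factor _ _ _)]div_factorC // div_factorC.
have crank_sum : div_factor 1 N.+1 (div_factor (-1) N.+1
    (mul_factor 0 N.+1 (zderiv (crank_prod N)))) m n =
  \sum_(j < N) (div_factor 1 j.+1 (crank_prod N.+1) m n
                - div_factor (-1) j.+1 (crank_prod N.+1) m n).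
  rewrite IH mul_factor_sum !div_factor_sum; apply: eq_bigr => j _.
  rewrite -!crank_div mul_factorB.
  by move: (mul_factor _ _ _) (mul_factor _ _ _) => A B; rewrite !div_factorB.
rewrite zderiv_div //; move: crank_sum; rewrite /= -zderiv_mul0.
move: (mul_factor 0 N.+1 _) => X <-.
have -> : zderiv (div_factor (-1) N.+1 X) = (fun m n => div_factor (-1) N.+1 (zderiv X) m n -
   (div_factor (-1) N.+1 (div_factor (-1) N.+1 X) m n - div_factor (-1) N.+1 X m n)).
  by apply: funext => ?; apply: funext => ?; rewrite zderiv_div // mulN1r.
rewrite !div_factorB mul1r [div_factor (-1) _ (div_factor 1 _ _)]div_factorC //.
ring.
Qed.

(** * Moments of the crank product *)

(** This is literally the inner sum of [crank_moment], so [norm_crank_momentE] holds by conversion.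
    Such a sum is 0 by convention on infinite support, which is why the linearity rules below assume
    [supported]. *)
Definition zsum (f : int -> int) : int := \sum_(m \in [set: int]) f m.

Definition supported (B : nat) (f : int -> int) : Prop :=
  forall m, (B < `|m|)%N -> f m = 0.

Lemma zsumE (B : nat) (f : int -> int) : supported B f ->
  zsum f = \sum_(i < (2 * B).+1) f (i%:Z - B%:Z).
Proof.
move=> fB; pose r : seq int := [seq i%:Z - B%:Z | i <- iota 0 (2 * B).+1].
have rP m : (m \in r) = (`|m| <= B)%N.
  apply/mapP/idP => [[i ]|mB]; first by rewrite mem_iota => iB ->; lia.
  by exists (absz (m + B%:Z)); rewrite ?mem_iota; lia.
rewrite /zsum -(fsbig_widen [set` r] setT) //; last first.
  by move=> m /= [_ /negP]; rewrite rP -ltnNge => /fB.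
rewrite -fsbig_seq; last by rewrite map_inj_uniq ?iota_uniq // => i j; lia.
by rewrite big_map -(big_mkord xpredT (fun i => f (i%:Z - B%:Z))) /index_iota subn0.
Qed.

Lemma zsum_ext (f g : int -> int) : f =1 g -> zsum f = zsum g.
Proof. by move=> /funext ->. Qed.

Lemma zsum_shift (e : int) (f : int -> int) : zsum (fun m => f (m - e)) = zsum f.
Proof.
rewrite /zsum (reindex_fsbigT (fun m => m + e)).
  by apply: eq_fsbigr => m _; rewrite addrK.
by exists (fun m => m - e) => m; rewrite ?addrK ?subrK.
Qed.

Lemma zsum_sum (B : nat) (I : Type) (s : seq I) (P : pred I) (f : I -> int -> int) :
  (forall i, P i -> supported B (f i)) ->
  zsum (fun m => \sum_(i <- s | P i) f i m) = \sum_(i <- s | P i) zsum (f i).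
Proof.
move=> fB; rewrite (zsumE (B := B)) => [|m mB]; last by rewrite big1 // => i /fB ->.
by rewrite exchange_big; apply: eq_bigr => i /fB /zsumE.
Qed.

Lemma zsumZ (c : int) (f : int -> int) (B : nat) : supported B f ->
  zsum (fun m => c * f m) = c * zsum f.
Proof.
move=> fB; rewrite !(zsumE (B := B)) // => [|m mB]; last by rewrite fB ?mulr0.
by rewrite mulr_sumr.
Qed.

Lemma zsumB (f g : int -> int) (B : nat) : supported B f -> supported B g ->
  zsum (fun m => f m - g m) = zsum f - zsum g.
Proof.
move=> fB gB; rewrite !(zsumE (B := B)) // => [|m mB]; last by rewrite fB ?gB.
by rewrite sumrB.
Qed.

Lemma supportedM (B : nat) (g f : int -> int) : supported B f -> supported B (fun m => g m * f m).
Proof. by move=> fB m /fB ->; rewrite mulr0. Qed.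

(** Each factor involves only z^e q^j with |e| <= j, so the exponent of z never exceeds that of q in
    absolute value; all sums over Z are then finite. *)
Definition triangular (F : qlaurent) : Prop := forall n, supported n (fun m => F m n).

Lemma triangular_mul (e : int) (j : nat) (F : qlaurent) :
  (`|e| <= j)%N -> triangular F -> triangular (mul_factor e j F).
Proof.
move=> ej FT n m mn; rewrite /mul_factor FT //.
by case: ifP => // jn; rewrite FT ?subr0 //; lia.
Qed.

Lemma triangular_div (e : int) (j : nat) (F : qlaurent) :
  (`|e| <= j)%N -> triangular F -> triangular (div_factor e j F).
Proof.
move=> ej FT n m mn; rewrite /div_factor big1 // => r _; apply: FT.
have rn : (r * j <= n)%N by rewrite (leq_trans _ (leq_divM n j)) // leq_mul2r -ltnS ltn_ord orbT.
have : (absz (e * r%:Z)%R <= r * j)%N by rewrite abszM mulnC leq_mul2l ej orbT.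
lia.
Qed.

Lemma triangular_crank_prod (N : nat) : triangular (crank_prod N).
Proof.
elim: N => [|N IH] /=.
  by move=> n m mn /=; rewrite /qlaurent1; case: eqP mn => // ->.
by do 2 (apply: triangular_div => //); apply: triangular_mul.
Qed.

Lemma triangular_crankM : triangular crankM.
Proof. by move=> n m mn; exact: triangular_crank_prod. Qed.

Definition moment (k n : nat) : int := zsum (fun m => m ^+ k * crankM m n).

Lemma sum_even_odd (V : nmodType) (f : nat -> V) (K : nat) :
  \sum_(i < 2 * K) f i = \sum_(t < K) (f (2 * t)%N + f (2 * t).+1).
Proof.
elim: K => [|K IH]; first by rewrite muln0 !big_ord0.
by rewrite mulnS addnC addn2 !big_ord_recr /= IH addrA.
Qed.

(** The even powers of y cancel, and an odd total degree leaves even powers of x: this is what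
    closes the recurrence on even moments. *)
Lemma expB_odd (R : comPzRingType) (K : nat) (x y : R) :
  (x + y) ^+ (2 * K).+1 - (x - y) ^+ (2 * K).+1 =
  2 * \sum_(t < K.+1) 'C((2 * K).+1, (2 * t).+1)%:R * y ^+ (2 * t).+1 * x ^+ (2 * (K - t)).
Proof.
rewrite !exprDn -sumrB; have -> : (2 * K).+2 = (2 * K.+1)%N by lia.
rewrite (sum_even_odd (fun i => x ^+ ((2 * K).+1 - i) * y ^+ i *+ 'C((2 * K).+1, i) -
  x ^+ ((2 * K).+1 - i) * (- y) ^+ i *+ 'C((2 * K).+1, i))).
rewrite mulr_sumr; apply: eq_bigr => t _.
have -> : ((2 * K).+1 - (2 * t).+1 = 2 * (K - t))%N by lia.
have -> : (- y) ^+ (2 * t) = y ^+ (2 * t) by rewrite !exprM sqrrN.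
have -> : (- y) ^+ (2 * t).+1 = - y ^+ (2 * t).+1 by rewrite !exprS !exprM sqrrN mulNr.
rewrite subrr add0r mulrN mulNrn opprK -[_ *+ _]mulr_natl.
by move: (_ ^+ (2 * (K - t))) (_ ^+ _.+1) => a b; ring.
Qed.

(** The truncation at N = n is exact for all coefficients up to q^n, so [crank_prodE] replaces every
    coefficient met in the geometric expansions by [crankM]. *)
Lemma crankM_deriv (m : int) (n : nat) :
  m * crankM m n = \sum_(j < n) \sum_(r < n.+1 | (r * j.+1 <= n)%N)
    (crankM (m - r%:Z) (n - r * j.+1) - crankM (m + r%:Z) (n - r * j.+1)).
Proof.
rewrite -[LHS]/(zderiv (crank_prod n) m n) zderiv_crank_prod; apply: eq_bigr => j _.
rewrite !(div_factor_qshiftE (B := n.+1)) // -sumrB [RHS]big_mkcond; apply: eq_bigr => r _.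
rewrite /qshift; case: ifP => jn; last by rewrite subr0.
by rewrite !crank_prodE ?leq_subr // mul1r mulN1r opprK.
Qed.

(** Multiply [crankM_deriv] by m^(2K+1), sum over m and translate m by r or -r: the weight of M(m, n
    - r j) becomes (m + r)^(2K+1) - (m - r)^(2K+1), to which [expB_odd] applies. *)
Lemma moment_double_sum (K n : nat) :
  moment (2 * K.+1) n = \sum_(j < n) \sum_(r < n.+1 | (r * j.+1 <= n)%N)
    2 * \sum_(t < K.+1) 'C((2 * K).+1, (2 * t).+1)%:R * r%:Z ^+ (2 * t).+1
       * moment (2 * (K - t)) (n - r * j.+1).
Proof.
pose f (j r : nat) (e : int) m := m ^+ (2 * K).+1 * crankM (m - e * r%:Z) (n - r * j.+1).
(* The support lies in |m| <= r + (n - r (j + 1)), hence in |m| <= 2n uniformly in j and r. *)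
have fB j r e : (r <= n)%N -> (`|e| = 1)%N -> supported (n + n) (f j r e).
  move=> rn e1 m mn; rewrite /f triangular_crankM ?mulr0 //.
  have : absz (e * r%:Z)%R = r by rewrite abszM e1 mul1n.
  lia.
transitivity (zsum (fun m => \sum_(j < n) \sum_(r < n.+1 | (r * j.+1 <= n)%N)
    (f j r 1 m - f j r (-1) m))).
  apply: zsum_ext => m; have -> : (2 * K.+1 = (2 * K).+2)%N by lia.
  rewrite exprSr -mulrA crankM_deriv mulr_sumr; apply: eq_bigr => j _.
  by rewrite mulr_sumr; apply: eq_bigr => r _; rewrite mulrBr /f mul1r mulN1r opprK.
have fBB j r m : (r <= n)%N -> (n + n < `|m|)%N -> f j r 1 m - f j r (-1) m = 0.
  by move=> rn mn; rewrite (fB j r 1) ?(fB j r (-1)) // subr0.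
rewrite (zsum_sum (B := n + n)); last first.
  by move=> j _ m mn; rewrite big1 // => r _; apply: fBB => //; rewrite -ltnS.
apply: eq_bigr => j _; rewrite (zsum_sum (B := n + n)); last first.
  by move=> r _ m mn; apply: fBB => //; rewrite -ltnS.
apply: eq_bigr => r rj.
have rn : (r <= n)%N by rewrite -ltnS.
rewrite (zsumB (B := n + n)); [|exact: fB|exact: fB].
rewrite -(zsum_shift (- r%:Z) (f j r 1)) -(zsum_shift r%:Z (f j r (-1))).
set n' := (n - r * j.+1)%N.
have supp g : supported n' (fun m => g m * crankM m n').
  by apply: supportedM; exact: triangular_crankM.
rewrite -(zsumB (B := n + n)); last 2 first.
- move=> m mn; rewrite /f triangular_crankM ?mulr0 //; lia.
- move=> m mn; rewrite /f triangular_crankM ?mulr0 //; lia.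
transitivity (zsum (fun m => 2 * \sum_(t < K.+1)
   'C((2 * K).+1, (2 * t).+1)%:R * r%:Z ^+ (2 * t).+1 * (m ^+ (2 * (K - t)) * crankM m n'))).
  apply: zsum_ext => m; rewrite /f -/n' mul1r mulN1r !opprK addrK subrK -mulrBl expB_odd.
  by rewrite -mulrA mulr_suml; congr (_ * _); apply: eq_bigr => t _; rewrite !mulrA.
rewrite (zsumZ _ (B := n')); last first.
  by move=> m mn; rewrite big1 // => t _; rewrite triangular_crankM ?mulr0.
congr (_ * _); rewrite (zsum_sum (B := n')); last first.
  by move=> t _; apply: supportedM; apply: supp.
by apply: eq_bigr => t _; rewrite (zsumZ _ (B := n')).
Qed.

Definition cauchy_prod (R : pzSemiRingType) (u v : nat -> R) : nat -> R :=
  fun n => \sum_(s < n.+1) u s * v (n - s)%N.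

(* [sigma k 0] is the junk value 1, because [divisors 0 = [:: 1]]. *)
Definition sigma0 (k s : nat) : int := if s is 0 then 0 else (sigma k s)%:Z.

(** Group the pairs (r, j) by the product s = r (j + 1): for s > 0, r runs over the divisors of s,
    and the powers r^(2t+1) add up to sigma_(2t+1)(s). *)
Lemma moment_rec (K n : nat) :
  moment (2 * K.+1) n = 2 * \sum_(t < K.+1) 'C((2 * K).+1, (2 * t).+1)%:R *
    cauchy_prod (sigma0 (2 * t).+1) (moment (2 * (K - t))) n.
Proof.
rewrite moment_double_sum.
transitivity (\sum_(j < n) \sum_(r < n.+1) \sum_(t < K.+1)  \sum_(s < n.+1 | (r * j.+1 == s)%N)
    (2 * 'C((2 * K).+1, (2 * t).+1)%:R * r%:Z ^+ (2 * t).+1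
       * moment (2 * (K - t)) (n - s))).
  apply: eq_bigr => j _; rewrite big_mkcond; apply: eq_bigr => r _.
  case: ifPn => [rj|]; last first.
    rewrite -ltnNge => rj; rewrite big1 // => t _; rewrite big1 // => s /eqP sE.
    by have := ltn_ord s; rewrite -sE ltnS leqNgt rj.
  rewrite mulr_sumr; apply: eq_bigr => t _; rewrite -ltnS in rj.
  by rewrite (big_pred1 (Ordinal rj)) ?mulrA // => s; rewrite eq_sym.
under eq_bigr do rewrite exchange_big /=.
rewrite exchange_big mulr_sumr; apply: eq_bigr => t _ /=.
rewrite /cauchy_prod !mulr_sumr.
under eq_bigr do rewrite (exchange_big_dep xpredT) //=.
rewrite exchange_big; apply: eq_bigr => s _ /=.
rewrite !mulrA -[2 * _ * _ * _]mulrA.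
transitivity (\sum_(j < n) \sum_(r < n.+1 | (r * j.+1 == s)%N) 2 * 'C((2 * K).+1, (2 * t).+1)%:R *
   (r%:Z ^+ (2 * t).+1 * moment (2 * (K - t)) (n - s))).
  by apply: eq_bigr => j _; apply: eq_bigr => r _; rewrite mulrA.
under eq_bigr do rewrite -mulr_sumr -mulr_suml.
rewrite -mulr_sumr -mulr_suml; congr (_ * (_ * _)).
(* The value s = 0 comes from r = 0 only, whose odd power vanishes, in agreement with [sigma0]. *)
have [s0|s_gt0] := posnP s.
  rewrite s0 /=; apply: big1 => j _; apply: big1 => r.
  by rewrite muln_eq0 orbF => /eqP ->; rewrite expr0n.
have -> : sigma0 (2 * t).+1 s = (sigma (2 * t).+1 s)%:Z by case: (s : nat) s_gt0.
rewrite (exchange_big_dep xpredT) //= /sigma.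
have dvd_small d : (d %| s)%N -> (d < n.+1)%N.
  by move=> /(dvdn_leq s_gt0) /leq_ltn_trans; apply.
transitivity (\sum_(r < n.+1 | (r %| s)%N) r%:Z ^+ (2 * t).+1).
  rewrite [RHS]big_mkcond; apply: eq_bigr => r _; case: ifPn => [rs|rs]; last first.
    by apply: big1 => j /eqP sE; case/negP: rs; rewrite -sE dvdn_mulr.
  have r_gt0 := dvdn_gt0 s_gt0 rs.
  have q0 : (0 < s %/ r)%N by rewrite (divn_gt0 _ r_gt0) (dvdn_leq s_gt0 rs).
  have qn : ((s %/ r).-1 < n)%N.
    by rewrite prednK //; rewrite (leq_trans (leq_div _ _)) // -ltnS.
  rewrite (big_pred1 (Ordinal qn)) // => j; rewrite /pred1 /= -val_eqE /= -[RHS]eqSS prednK //.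
  by rewrite -[RHS](eqn_pmul2l r_gt0) [X in _ = (_ == X)]mulnC divnK.
have /(perm_big _) -> : perm_eq (divisors s) [seq d <- iota 0 n.+1 | (d %| s)%N].
  apply: uniq_perm; rewrite ?divisors_uniq ?filter_uniq ?iota_uniq // => d.
  rewrite -dvdn_divisors // mem_filter mem_iota add0n /=.
  by case: (boolP (d %| s)%N) => // /dvd_small ->.
rewrite big_filter -(big_mkord (fun r => (r %| s)%N) (fun r => r%:Z ^+ (2 * t).+1)).
rewrite /index_iota subn0 -natz natr_sum; apply: eq_bigr => d _.
by rewrite natrX natz.
Qed.

(** Summing over m sets z = 1: a translation in m does not change the sum, so the exponent of z in
    the denominator is irrelevant. *)
Lemma zsum_div_factor (e : int) (j n : nat) (F : qlaurent) :
  (0 < j)%N -> (`|e| <= j)%N -> triangular F ->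
  zsum (fun m => div_factor e j F m n) = zsum (fun m => div_factor 0 j F m n).
Proof.
move=> j0 ej FT; suff sumE d : (`|d| <= j)%N -> zsum (fun m => div_factor d j F m n) =
    \sum_(r < (n %/ j).+1) zsum (fun m => F m (n - r * j)%N) by rewrite !sumE.
move=> dj; rewrite (zsum_sum (B := (n + n)%N)).
  by apply: eq_bigr => r _; rewrite (zsum_shift (d * r%:Z) (fun m => F m (n - r * j)%N)).
move=> r _ m mn; apply: FT.
have rn : (r * j <= n)%N by rewrite (leq_trans _ (leq_divM n j)) // leq_mul2r -ltnS ltn_ord orbT.
have : (absz (d * r%:Z)%R <= r * j)%N by rewrite abszM mulnC leq_mul2l dj orbT.
lia.
Qed.

(* The number of partitions of n into parts of size at most N. *)
Definition npart (N n : nat) : int := zsum (fun m => crank_prod N m n).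

(** At z = 1 one of the two denominators 1 - q^(N+1) cancels the numerator, leaving a single
    division by 1 - q^(N+1); the recurrence clears it. Combinatorially, a part of size N+1 is either
    absent or can be removed. *)
Lemma npart_rec (N n : nat) :
  npart N.+1 n = npart N n + (if (N < n)%N then npart N.+1 (n - N.+1)%N else 0).
Proof.
pose G := div_factor 0 N.+1 (crank_prod N).
have GT : triangular G by apply: triangular_div => //; apply: triangular_crank_prod.
have npartG n' : npart N.+1 n' = zsum (fun m => G m n').
  rewrite /npart /= zsum_div_factor //; last first.
    apply: triangular_div => //; apply: triangular_mul => //; exact: triangular_crank_prod.
  rewrite div_factorC // div_mul_factor // zsum_div_factor //; exact: triangular_crank_prod.
rewrite !npartG; apply/eqP; rewrite -subr_eq; apply/eqP.
have -> : npart N n = zsum (fun m => mul_factor 0 N.+1 G m n).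
  by rewrite mul_div_factor.
rewrite /mul_factor; case: ifP => Nn; last by rewrite !subr0; apply: zsum_ext => m; rewrite subr0.
rewrite -(zsumB (B := n)) //.
  by apply: zsum_ext => m; rewrite subr0.
by move=> m mn; apply: GT; lia.
Qed.

Lemma npart0 (n : nat) : npart 0 n = (n == 0%N)%:R.
Proof.
rewrite /npart (zsumE (B := 0)) /=; last first.
  by move=> m; rewrite /qlaurent1; case: eqP => // ->.
by rewrite big_ord1 /qlaurent1 subr0 eqxx.
Qed.

Lemma moment0 (N n : nat) : (n <= N)%N -> moment 0 n = npart N n.
Proof. by move=> nN; apply: zsum_ext => m; rewrite expr0 mul1r crank_prodE. Qed.

(** Positivity appears only after summation over m, since M(0, 1) = -1. It makes the moduli of the
    terms equal to the same series at |q|. *)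
Lemma npart_ge0 (N n : nat) : 0 <= npart N n.
Proof.
elim: N n => [|N IH] n; first by rewrite npart0.
elim/ltn_ind: n => n IHn; rewrite npart_rec addr_ge0 //.
by case: ifP => // Nn; apply: IHn; lia.
Qed.

Lemma npart_le (N n : nat) : npart N n <= npart N.+1 n.
Proof. by rewrite npart_rec lerDl; case: ifP => // _; apply: npart_ge0. Qed.

(** * Absolutely convergent series *)

Lemma sum_cauchy_prod (R : pzSemiRingType) (u v : nat -> R) (N : nat) :
  \sum_(n < N) cauchy_prod u v n = \sum_(i < N) \sum_(j < N | (i + j < N)%N) u i * v j.
Proof.
transitivity (\sum_(n < N) \sum_(i < N) \sum_(j < N | (i + j == n)%N) u i * v j).
  apply: eq_bigr => n _; rewrite /cauchy_prod.
  rewrite (big_ord_widen_cond N xpredT (fun s => u s * v (n - s)%N)) //.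
  rewrite big_mkcond; apply: eq_bigr => i _ /=; rewrite ltnS; case: ifPn => [ij|].
    have nN : (n - i < N)%N by rewrite (leq_ltn_trans (leq_subr _ _)).
    by rewrite (big_pred1 (Ordinal nN)) // => j; rewrite /pred1 /= -val_eqE /=; lia.
  by rewrite -ltnNge => ni; rewrite big1 // => j /eqP; lia.
rewrite exchange_big; apply: eq_bigr => i _ /=.
rewrite (exchange_big_dep xpredT) //= [RHS]big_mkcond; apply: eq_bigr => j _.
case: ifPn => [ij|]; first by rewrite (big_pred1 (Ordinal ij)) // => n; rewrite eq_sym.
by move=> ij; rewrite big1 // => n /eqP nE; move: ij; rewrite nE ltn_ord.
Qed.

Lemma cauchy_prod_exp (R : comPzSemiRingType) (u v : nat -> R) (q : R) (n : nat) :
  cauchy_prod (fun n => u n * q ^+ n) (fun n => v n * q ^+ n) n = cauchy_prod u v n * q ^+ n.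
Proof.
rewrite /cauchy_prod mulr_suml; apply: eq_bigr => s _.
by rewrite mulrACA -exprD subnKC // -ltnS.
Qed.

Section RealSeries.
Import numFieldNormedType.Exports.
Local Open Scope classical_set_scope.
Variable R : realType.
Implicit Types u v : nat -> R.

Lemma nonneg_series_cvg u (B : R) : (forall n, 0 <= u n) ->
  (forall N, \sum_(n < N) u n <= B) -> cvgn (series u).
Proof.
move=> u0 uB; apply: nondecreasing_is_cvgn.
  by apply: nondecreasing_series => n _ _; apply: u0.
by exists B => _ [N _ <-]; rewrite seriesEord; apply: uB.
Qed.

(** The triangle i + j < N lies in the square i, j < N; conversely, in the next lemma, that square
    lies in the triangle i + j < 2N. *)
Lemma sum_cauchy_prod_le u v N : (forall n, 0 <= u n) -> (forall n, 0 <= v n) ->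
  \sum_(n < N) cauchy_prod u v n <= (\sum_(n < N) u n) * (\sum_(n < N) v n).
Proof.
move=> u0 v0; rewrite sum_cauchy_prod mulr_suml; apply: ler_sum => i _.
rewrite mulr_sumr [leLHS]big_mkcond; apply: ler_sum => j _.
by case: ifP => // _; rewrite mulr_ge0.
Qed.

Lemma sum_cauchy_prod_ge u v N : (forall n, 0 <= u n) -> (forall n, 0 <= v n) ->
  (\sum_(n < N) u n) * (\sum_(n < N) v n) <= \sum_(n < 2 * N) cauchy_prod u v n.
Proof.
move=> u0 v0; rewrite sum_cauchy_prod mulr_suml.
have NN : (N <= 2 * N)%N by lia.
rewrite (big_ord_widen_cond _ xpredT (fun i => u i * \sum_(n < N) v n) NN) big_mkcond /=.
apply: ler_sum => i _; case: ifPn => [iN|_]; last by apply: sumr_ge0 => j _; rewrite mulr_ge0.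
rewrite mulr_sumr (big_ord_widen_cond _ xpredT (fun j => u i * v j) NN).
rewrite big_mkcond [leRHS]big_mkcond /=.
apply: ler_sum => j _; case: ifPn => [jN|_]; last by case: ifP => // _; rewrite mulr_ge0.
by rewrite ifT //; lia.
Qed.

Lemma cauchy_prod_ge0 u v n : (forall n, 0 <= u n) -> (forall n, 0 <= v n) ->
  0 <= cauchy_prod u v n.
Proof. by move=> u0 v0; apply: sumr_ge0 => s _; rewrite mulr_ge0. Qed.

Lemma cauchy_prod_defect_cvg u v (A B : R) : (forall n, 0 <= u n) -> (forall n, 0 <= v n) ->
  (forall N, \sum_(n < N) u n <= A) -> (forall N, \sum_(n < N) v n <= B) ->
  (\sum_(n < N) u n) * (\sum_(n < N) v n) - \sum_(n < N) cauchy_prod u v n @[N --> \oo] --> (0 : R).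
Proof.
move=> u0 v0 uA vB.
have uc := nonneg_series_cvg u0 uA; have vc := nonneg_series_cvg v0 vB.
have w0 n : 0 <= cauchy_prod u v n by apply: cauchy_prod_ge0.
have wc : cvgn (series (cauchy_prod u v)).
  apply: (@nonneg_series_cvg _ (A * B)) => // N.
  by rewrite (le_trans (sum_cauchy_prod_le _ u0 v0)) // ler_pM ?sumr_ge0.
have wE : limn (series (cauchy_prod u v)) = limn (series u) * limn (series v).
  rewrite -limM //; apply/eqP; rewrite eq_le; apply/andP; split.
    apply: ler_lim => //; first exact: is_cvgM.
    by apply: nearW => N /=; rewrite !seriesEord /=; apply: sum_cauchy_prod_le.
  apply: limr_le; first exact: is_cvgM.
  apply: nearW => N /=; rewrite (le_trans (y := series (cauchy_prod u v) (2 * N)%N)) //.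
    by rewrite !seriesEord /=; apply: sum_cauchy_prod_ge.
  by apply: nondecreasing_cvgn_le => //; apply: nondecreasing_series => n _ _.
have := (cvgB (cvgM uc vc) wc : (fun N => series u N * series v N -
  series (cauchy_prod u v) N) @ \oo --> _).
rewrite wE subrr.
by rewrite !seriesEord; apply.
Qed.

End RealSeries.

Section ComplexSeries.
Import numFieldNormedType.Exports.
Local Open Scope classical_set_scope.
Variable R : realType.
Implicit Types (z : R[i]) (u v : nat -> R[i]).

(** The norm of [R[i]] takes its values in [R[i]]; bounds and monotone convergence are carried out
    in [R]. *)
Definition cabs z : R := complex.Re `|z|.

Lemma cabsE z : `|z| = (cabs z)%:C.
Proof. by rewrite /cabs normc_def. Qed.

Lemma cabs_ge0 z : 0 <= cabs z.
Proof. by rewrite -ler0c -cabsE. Qed.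

Lemma cabs0 : cabs 0 = 0.
Proof. by rewrite /cabs normr0. Qed.

Lemma cabs1 : cabs 1 = 1.
Proof. by rewrite /cabs normr1. Qed.

Lemma cabsM z z' : cabs (z * z') = cabs z * cabs z'.
Proof. by apply: complexI; rewrite rmorphM /= -!cabsE normrM. Qed.

Lemma cabsX z n : cabs (z ^+ n) = cabs z ^+ n.
Proof. by apply: complexI; rewrite rmorphXn /= -!cabsE normrX. Qed.

Lemma cabsD z z' : cabs (z + z') <= cabs z + cabs z'.
Proof. by rewrite -lecR rmorphD /= -!cabsE ler_normD. Qed.

Lemma cabsN z : cabs (- z) = cabs z.
Proof. by apply: complexI; rewrite -!cabsE normrN. Qed.

Lemma cabs_sum (I : Type) (s : seq I) (P : pred I) (F : I -> R[i]) :
  cabs (\sum_(i <- s | P i) F i) <= \sum_(i <- s | P i) cabs (F i).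
Proof.
rewrite -lecR rmorph_sum /= -cabsE (le_trans (ler_norm_sum _ _ _)) //.
Qed.

Lemma cabs_real (x : R) : cabs x%:C = `|x|.
Proof. by rewrite /cabs normc_def /= expr0n addr0 sqrtr_sqr. Qed.

Lemma cabs_int (m : int) : cabs m%:~R = `|m%:~R|.
Proof. by rewrite -cabs_real rmorph_int. Qed.

Lemma cabs_Re z : `|complex.Re z| <= cabs z.
Proof. by rewrite -lecR -cabsE normc_ge_Re. Qed.

Lemma cabs_Im z : `|complex.Im z| <= cabs z.
Proof.
rewrite /cabs normc_def /= -sqrtr_sqr ler_sqrt ?lerDr ?sqr_ge0 //.
by rewrite addr_ge0 ?sqr_ge0.
Qed.

Lemma real_complex_cvg (x : nat -> R) (a : R) :
  x @ \oo --> a -> (fun n => (x n)%:C : R[i]^o) @ \oo --> (a%:C : R[i]^o).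
Proof.
move=> /cvgrPdist_lt xa; apply/cvgrPdist_lt => e; rewrite ltcE => /andP[/eqP /= e0 epos].
have := xa _ epos; apply: filterS => n.
rewrite -rmorphB /= normc_def /= expr0n addr0 sqrtr_sqr.
by rewrite ltcE /= e0 eqxx.
Qed.

Lemma cabs_le_cvg0 (z : nat -> R[i]^o) (d : nat -> R) : (forall n, cabs (z n) <= d n) ->
  d @ \oo --> (0 : R) -> z @ \oo --> (0 : R[i]^o).
Proof.
move=> zd /cvgrPdist_lt d0; apply/cvgrPdist_lt => e; rewrite ltcE => /andP[/eqP /= e0 epos].
have := d0 _ epos; apply: filterS => n; rewrite !sub0r !normrN cabsE => dn.
rewrite ltcE /= e0 eqxx /=; apply: le_lt_trans dn.
by rewrite (le_trans (zd n)) // ler_norm.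
Qed.

(** A bound on partial sums rather than a limit: it passes through linear combinations and Cauchy
    products by inequalities alone. *)
Definition abs_summable u : Prop := exists B : R, forall N, \sum_(n < N) cabs (u n) <= B.

Lemma abs_summable_real_cvg (x : nat -> R) u : (forall n, `|x n| <= cabs (u n)) ->
  abs_summable u -> cvgn (series x).
Proof.
move=> xu [B uB]; apply: normed_cvg; apply: (@nonneg_series_cvg _ _ B) => [n /=|N] //.
by rewrite (le_trans _ (uB N)) // ler_sum // => n _; apply: xu.
Qed.

Lemma partial_sumsE u :
  (fun N => \sum_(n < N) u n : R[i]^o) = (fun N => \sum_(0 <= n < N) u n : R[i]^o).
Proof. by apply: funext => N; rewrite big_mkord. Qed.

Lemma abs_summable_cvg u : abs_summable u ->
  (fun N => \sum_(n < N) u n : R[i]^o) @ \oo --> (csum u : R[i]^o).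
Proof.
move=> su.
have rc := @abs_summable_real_cvg (fun n => complex.Re (u n)) u (fun n => cabs_Re _) su.
have ic := @abs_summable_real_cvg (fun n => complex.Im (u n)) u (fun n => cabs_Im _) su.
set a := limn (series _) in rc; set b := limn (series _) in ic.
have uc : (fun N => \sum_(0 <= n < N) u n : R[i]^o) @ \oo -->
    (a%:C + 'i%C * b%:C : R[i]^o).
  rewrite (_ : (fun N => _) = (fun N => (series (fun n => complex.Re (u n)) N)%:C +
      'i%C * (series (fun n => complex.Im (u n)) N)%:C : R[i]^o)); last first.
    apply: funext => N; rewrite !seriesEnat /= !rmorph_sum mulr_sumr -big_split.
    by apply: eq_bigr => n _ /=; rewrite -complexE.
  exact: (cvgD (real_complex_cvg rc) (cvgM (cvg_cst _) (real_complex_cvg ic))).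
by rewrite /csum (cvg_lim _ uc) // partial_sumsE.
Qed.

Lemma csum_eq u (l : R[i]) :
  (fun N => \sum_(n < N) u n : R[i]^o) @ \oo --> (l : R[i]^o) -> csum u = l.
Proof.
by rewrite partial_sumsE => uc; rewrite /csum (cvg_lim _ uc).
Qed.

Lemma abs_summable_cauchy_prod u v : abs_summable u -> abs_summable v ->
  abs_summable (cauchy_prod u v).
Proof.
move=> [A uA] [B vB]; exists (A * B) => N.
pose a n := cabs (u n); pose b n := cabs (v n).
have a0 n : 0 <= a n by apply: cabs_ge0.
have b0 n : 0 <= b n by apply: cabs_ge0.
apply: (@le_trans _ _ (\sum_(n < N) cauchy_prod a b n)).
  apply: ler_sum => n _; apply: (le_trans (cabs_sum _ _ _)); apply: ler_sum => s _.
  by rewrite cabsM.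
by rewrite (le_trans (sum_cauchy_prod_le _ a0 b0)) // ler_pM ?sumr_ge0.
Qed.

(** The product of the partial sums minus the partial sum of the Cauchy product is the sum of u_i
    v_j over i, j < N with i + j >= N. Its modulus is at most the same defect for |u| and |v|, which
    tends to 0 by [cauchy_prod_defect_cvg]. *)
Lemma csum_cauchy_prod u v : abs_summable u -> abs_summable v ->
  csum (cauchy_prod u v) = csum u * csum v.
Proof.
move=> su sv; have uc := abs_summable_cvg su; have vc := abs_summable_cvg sv.
case: su => A uA; case: sv => B vB; apply: csum_eq.
rewrite -[X in _ --> X]subr0.
have d0 := cauchy_prod_defect_cvg (fun n => cabs_ge0 (u n)) (fun n => cabs_ge0 (v n)) uA vB.
rewrite (_ : (fun N => _) = (fun N => (\sum_(n < N) u n) * (\sum_(n < N) v n) -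
  ((\sum_(n < N) u n) * (\sum_(n < N) v n) - \sum_(n < N) cauchy_prod u v n) : R[i]^o)); last first.
  by apply: funext => N; rewrite opprB addrC subrK.
apply: (cvgB (cvgM uc vc)); apply: (cabs_le_cvg0 _ d0) => N.
rewrite !sum_cauchy_prod !mulr_suml -!sumrB.
apply: (le_trans (cabs_sum _ _ _)); apply: ler_sum => i _; rewrite !mulr_sumr.
rewrite [X in X - _](bigID (fun j : 'I_N => (i + j < N)%N)) /= [X in cabs X]addrC addKr.
rewrite [X in _ <= X - _](bigID (fun j : 'I_N => (i + j < N)%N)) /= [leRHS]addrC addKr.
by apply: (le_trans (cabs_sum _ _ _)); apply: ler_sum => j _; rewrite cabsM.
Qed.

End ComplexSeries.

(** * The Euler product *)

Lemma sum_delay (V : nmodType) (j : nat) (f : nat -> V) (M : nat) :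
  \sum_(n < M + j) (if (j <= n)%N then f (n - j)%N else 0) = \sum_(n < M) f n.
Proof.
elim: M => [|M IH]; last by rewrite addSn !big_ord_recr /= IH leq_addl addnK.
by rewrite big_ord0 big1 // => n _; rewrite leqNgt ltn_ord.
Qed.

Section RealBounds.
Variable R : realType.
Variable r : R.
Hypotheses (r0 : 0 <= r) (r1 : r < 1).

Let r1' : 0 < 1 - r. Proof. by rewrite subr_gt0. Qed.

Lemma geometric_sum_le (N : nat) : \sum_(j < N) r ^+ j <= (1 - r)^-1.
Proof.
rewrite -[leRHS]div1r ler_pdivlMr // mulrC -opprB mulNr -subrX1 opprB.
by rewrite gerBl exprn_ge0.
Qed.

(** Let S_N be the partial sum up to M. Delaying a nonnegative series only decreases its partial
    sums, so S_(N+1) <= S_N + r^(N+1) S_(N+1), and one divides by 1 - r^(N+1). *)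
Lemma npart_sum_le (N M : nat) :
  \sum_(n < M) (npart N n)%:~R * r ^+ n <= \prod_(j < N) (1 - r ^+ j.+1)^-1.
Proof.
elim: N => [|N IH].
  rewrite big_ord0; case: M => [|M]; first by rewrite big_ord0.
  by rewrite big_ord_recl npart0 expr0 mulr1 big1 ?addr0 // => i _; rewrite npart0 mul0r.
have rN : 0 < 1 - r ^+ N.+1 by rewrite subr_gt0 exprn_ilt1.
rewrite big_ord_recr /= ler_pdivlMr // mulrBr mulr1 lerBlDr.
have f0 n : 0 <= (npart N.+1 n)%:~R * r ^+ n :> R.
  by rewrite mulr_ge0 ?exprn_ge0 // ler0z npart_ge0.
have E : \sum_(n < M) (npart N.+1 n)%:~R * r ^+ n = \sum_(n < M) (npart N n)%:~R * r ^+ n +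
    r ^+ N.+1 * \sum_(n < M) (if (N < n)%N then
      (npart N.+1 (n - N.+1))%:~R * r ^+ (n - N.+1) else 0) :> R.
  rewrite mulr_sumr -big_split; apply: eq_bigr => n _ /=; rewrite [in LHS]npart_rec rmorphD mulrDl.
  congr (_ + _); case: ifP => nN; rewrite ?(mul0r, mulr0) //.
  by rewrite mulrCA -exprD subnKC.
rewrite {1}E lerD // mulrC ler_wpM2r ?exprn_ge0 //.
rewrite -[leRHS](sum_delay N.+1 (fun n => (npart N.+1 n)%:~R * r ^+ n)).
rewrite big_split_ord lerDl; apply: sumr_ge0 => n _.
by case: ifP => // _; apply: f0.
Qed.

(** Since 1 / (1 - r^(j+1)) <= 1 + r^j / (1 - r) <= exp(r^j / (1 - r)), a geometric sum in the
    exponent gives the bound exp((1 - r)^-2). *)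
Lemma inv_prod_bound : exists B : R, forall N, \prod_(j < N) (1 - r ^+ j.+1)^-1 <= B.
Proof.
exists (expR ((1 - r)^-1 * (1 - r)^-1)) => N.
apply: (@le_trans _ _ (\prod_(j < N) expR (r ^+ j * (1 - r)^-1))).
  apply: ler_prod => j _; have rj : r ^+ j.+1 <= r.
    by rewrite exprS ler_piMr // exprn_ile1 // ltW.
  have rj1 : 0 < 1 - r ^+ j.+1 by rewrite subr_gt0 (le_lt_trans rj).
  rewrite invr_ge0 ltW //=; apply: le_trans (expR_ge1Dx _).
  rewrite -[leLHS]div1r ler_pdivrMr //.
  have : 1 <= (1 - r)^-1 * (1 - r ^+ j.+1).
    by rewrite mulrC ler_pdivlMr // mul1r lerD2l lerN2.
  have : r ^+ j.+1 <= r ^+ j by rewrite exprS ler_piMl ?exprn_ge0 // ltW.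
  have : 0 <= r ^+ j by rewrite exprn_ge0.
  move: (r ^+ j) (r ^+ j.+1) ((1 - r)^-1) => x y c x0 yx cy.
  have : 0 <= x * (c * (1 - y) - 1) by rewrite mulr_ge0 ?subr_ge0.
  nra.
rewrite -expR_sum ler_expR -mulr_suml ler_wpM2r ?invr_ge0 ?(ltW r1') //.
exact: geometric_sum_le.
Qed.

Lemma prod_1D_bound : exists B : R, forall N, \prod_(j < N) (1 + r ^+ j.+1) <= B.
Proof.
exists (expR ((1 - r)^-1)) => N.
apply: (@le_trans _ _ (\prod_(j < N) expR (r ^+ j))).
  apply: ler_prod => j _; rewrite addr_ge0 ?exprn_ge0 //=.
  apply: le_trans (expR_ge1Dx _); rewrite lerD2l.
  by rewrite exprS ler_piMl ?exprn_ge0 // ltW.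
by rewrite -expR_sum ler_expR geometric_sum_le.
Qed.

End RealBounds.

Lemma power_geometric_sum_bound (R : realType) (k : nat) (r : R) : 0 <= r -> r < 1 ->
  exists B : R, forall N, \sum_(n < N) n%:R ^+ k * r ^+ n <= B.
Proof.
elim: k r => [|k IH] r r0 r1.
  exists ((1 - r)^-1) => N; under eq_bigr do rewrite expr0 mul1r.
  exact: geometric_sum_le.
(* With s = sqrt r, n s^n is at most the geometric sum 1 + s + ... + s^(n-1), and
   r^n = s^n s^n. *)
have s0 : 0 <= Num.sqrt r by apply: sqrtr_ge0.
have s1 : Num.sqrt r < 1 by rewrite -sqrtr1 ltr_sqrt.
have [B HB] := IH _ s0 s1; exists (B * (1 - Num.sqrt r)^-1) => N.
apply: (@le_trans _ _ ((\sum_(n < N) n%:R ^+ k * Num.sqrt r ^+ n) * (1 - Num.sqrt r)^-1)).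
  rewrite mulr_suml; apply: ler_sum => n _.
  rewrite -[X in X ^+ n]sqr_sqrtr // -exprM mul2n -addnn exprD exprSr -!mulrA.
  rewrite ler_wpM2l ?exprn_ge0 ?ler0n // mulrCA ler_wpM2l ?exprn_ge0 //.
  apply: le_trans (geometric_sum_le s0 s1 n).
  rewrite -[X in X%:R * _]card_ord -sumr_const mulr_suml; apply: ler_sum => i _.
  by rewrite mul1r ler_wiXn2l ?(ltW s1) // ltnW.
by rewrite ler_wpM2r // invr_ge0 subr_ge0 ltW.
Qed.

Section Euler.
Import numFieldNormedType.Exports.
Local Open Scope classical_set_scope.
Variable R : realType.

Lemma cabs_cexp (z : R[i]) : cabs (cexp z) = expR (complex.Re z).
Proof.
rewrite /cexp cabsM cabs_real ger0_norm ?expR_ge0 //.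
by rewrite /cabs normc_def /= cos2Dsin2 sqrtr1 mulr1.
Qed.

Lemma cabs_nome_lt1 (tau : R[i]) : 0 < complex.Im tau -> cabs (nome tau) < 1.
Proof.
move=> tau0; rewrite cabs_cexp expR_lt1.
case: tau tau0 => a b /= b0; rewrite !(mul0r, mulr0, addr0, subr0, add0r, mul1r, mulr1, sub0r).
have := pi_gt0 R; nra.
Qed.

Variable q : R[i].
Hypothesis q1 : cabs q < 1.

Lemma qfactor_neq0 (j : nat) : 1 - q ^+ j.+1 != 0.
Proof.
rewrite subr_eq0; apply/eqP => /(congr1 (@cabs R)); rewrite cabsX cabs1 => E.
have : cabs q ^+ j.+1 < 1 by rewrite exprn_ilt1 ?cabs_ge0.
by rewrite -E ltxx.
Qed.

Definition qprod (N : nat) : R[i] := \prod_(j < N) (1 - q ^+ j.+1).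

Lemma qprod_neq0 (N : nat) : qprod N != 0.
Proof. by apply/prodf_neq0 => j _; apply: qfactor_neq0. Qed.

Definition qterm (a : nat -> int) (n : nat) : R[i] := (a n)%:~R * q ^+ n.

Lemma cabs_qterm (a : nat -> int) (n : nat) : 0 <= a n ->
  cabs (qterm a n) = (a n)%:~R * cabs q ^+ n.
Proof. by move=> a0; rewrite cabsM cabsX cabs_int ger0_norm // ler0z. Qed.

Lemma abs_summable_npart (N : nat) : abs_summable (qterm (npart N)).
Proof.
exists (\prod_(j < N) (1 - cabs q ^+ j.+1)^-1) => M.
under eq_bigr do rewrite cabs_qterm ?npart_ge0 //.
by apply: npart_sum_le => //; apply: cabs_ge0.
Qed.

(** The first N terms are also those of [npart N], and the bound on the latter is uniform in N. *)
Lemma abs_summable_moment0 : abs_summable (qterm (moment 0)).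
Proof.
have [B HB] := inv_prod_bound (cabs_ge0 q) q1; exists B => N; apply: le_trans (HB N).
apply: le_trans (npart_sum_le (cabs_ge0 q) q1 N N).
apply: ler_sum => n _; rewrite /qterm (@moment0 N) ?(ltnW (ltn_ord n)) //.
by rewrite -/(qterm _ _) cabs_qterm ?npart_ge0.
Qed.

(** The recurrence for [npart] reads (1 - q^(N+1)) S_(N+1) = S_N on sums; multiplication by q^(N+1)
    delays the partial sums by N+1, whence the shifted limits. *)
Lemma csum_npart (N : nat) : csum (qterm (npart N)) = (qprod N)^-1.
Proof.
elim: N => [|N IH].
  rewrite /qprod big_ord0 invr1; apply: csum_eq.
  apply: (@cvg_near_cst _ _ _ _ _ _ _); exists 1%N => // M /= M1.
  rewrite -(prednK M1) big_ord_recl /qterm npart0 expr0 mulr1 big1 ?addr0 // => i _.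
  by rewrite npart0 mul0r.
have cN := abs_summable_cvg (abs_summable_npart N).
have cN1 := abs_summable_cvg (abs_summable_npart N.+1).
suff E : csum (qterm (npart N.+1)) - q ^+ N.+1 * csum (qterm (npart N.+1)) = (qprod N)^-1.
  rewrite /qprod big_ord_recr /= invfM -/(qprod N) -E -[X in X - _]mul1r -mulrBl mulrAC.
  by rewrite mulfV ?mul1r ?qfactor_neq0.
rewrite -IH; apply/esym; apply: csum_eq.
rewrite -(cvg_shiftn N.+1) /= (_ : (fun M => _) =
  (fun M => \sum_(n < M + N.+1) qterm (npart N.+1) n -
    q ^+ N.+1 * \sum_(n < M) qterm (npart N.+1) n : R[i]^o)).
  move: (cN1); rewrite -(cvg_shiftn N.+1) => cN1'.
  exact: (cvgB cN1' (cvgM (cvg_cst _) cN1)).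
apply: funext => M; rewrite -(sum_delay N.+1 (qterm (npart N.+1)) M) mulr_sumr -sumrB.
apply: eq_bigr => n _; rewrite {2}/qterm npart_rec rmorphD mulrDl.
case: ifP => nN; rewrite ?(mul0r, mulr0, addr0, subr0) // /qterm.
by rewrite mulrCA -exprD subnKC // addrK.
Qed.

End Euler.

(** * Normalization of the zeroth crank moment and recurrence for the normalized moments *)

Section CrankMoments.
Import numFieldNormedType.Exports.
Local Open Scope classical_set_scope.
Variable R : realType.

Lemma cabs_lim_le (z : nat -> R[i]^o) (l : R[i]^o) (B : R) :
  z @ \oo --> l -> (forall n, cabs (z n) <= B) -> cabs l <= B.
Proof.
move=> /cvgrPdist_lt zl zB; apply/ler_addgt0Pr => e e0.
have e0' : 0 < e%:C :> R[i] by rewrite ltcR.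
have [n] := filter_ex (zl _ e0'); rewrite cabsE ltcR => zln.
rewrite -(subrK (z n) l) (le_trans (cabsD _ _)) // addrC lerD //.
exact: ltW.
Qed.

Variable q : R[i].
Hypothesis q1 : cabs q < 1.

(* [npart N n] equals [moment 0 n] for n <= N and is at most [moment 0 n] otherwise,
   so that the two series differ by a tail of the larger one. *)
Lemma cabs_moment0_tail (N M : nat) :
  cabs (\sum_(n < M) qterm q (moment 0) n - \sum_(n < M) qterm q (npart N) n) +
  \sum_(n < N) cabs (qterm q (moment 0) n) <= \sum_(n < M + N) cabs (qterm q (moment 0) n).
Proof.
pose f n := cabs (qterm q (moment 0) n).
rewrite [leRHS](bigID (fun n : 'I_(M + N) => (n < N)%N)) /= [leRHS]addrC lerD //; last first.
  by rewrite (big_ord_widen_cond (M + N) xpredT f) // leq_addl.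
rewrite -sumrB (le_trans (cabs_sum _ _ _)) //.
rewrite [leRHS]big_mkcond big_split_ord /= -[leLHS]addr0 lerD //; last first.
  by apply: sumr_ge0 => n _; case: ifP => // _; apply: cabs_ge0.
apply: ler_sum => n _; rewrite -leqNgt /f; case: leqP => nN.
  have le m : npart (N + m) n >= npart N n.
    by elim: m => [|m IH]; rewrite ?addn0 // addnS (le_trans IH) ?npart_le.
  have mN : npart N n <= moment 0 n.
    by have := le (n - N)%N; rewrite subnKC // (@moment0 n).
  rewrite /qterm -mulrBl -rmorphB /= -/(qterm q (fun n => moment 0 n - npart N n) n).
  rewrite !cabs_qterm ?subr_ge0 ?(le_trans (npart_ge0 N n)) //.
  by rewrite ler_wpM2r ?exprn_ge0 ?cabs_ge0 // ler_int lerBlDr lerDl npart_ge0.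
by rewrite /qterm (@moment0 N) ?(ltnW nN) // subrr cabs0.
Qed.

(** Letting M tend to infinity in [cabs_moment0_tail] bounds the distance to the limit by the N-th
    tail of the absolutely convergent series of [moment 0]. *)
Lemma inv_qprod_cvg :
  (fun N => (qprod q N)^-1 : R[i]^o) @ \oo --> (csum (qterm q (moment 0)) : R[i]^o).
Proof.
have sm := abs_summable_moment0 q1; have cm := abs_summable_cvg sm.
case: sm => B HB.
pose T := series (fun n => cabs (qterm q (moment 0) n)).
have Tc : cvgn T by apply: (nonneg_series_cvg _ HB) => n; apply: cabs_ge0.
have TE N : T N = \sum_(n < N) cabs (qterm q (moment 0) n) by rewrite /T seriesEord.
have d0 : (fun N => limn T - T N) @ \oo --> (0 : R).
  rewrite -(subrr (limn T)); exact: (cvgB (cvg_cst _) Tc).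
rewrite (_ : (fun N => _) = (fun N => csum (qterm q (moment 0)) -
    (csum (qterm q (moment 0)) - (qprod q N)^-1) : R[i]^o)); last first.
  by apply: funext => N; rewrite opprB addrC subrK.
rewrite -[X in _ --> X]subr0; apply: (cvgB (cvg_cst _)).
apply: (cabs_le_cvg0 _ d0) => N; rewrite -csum_npart //.
apply: (cabs_lim_le (cvgB cm (abs_summable_cvg (abs_summable_npart q1 N)))) => M.
rewrite lerBrDr TE (le_trans (cabs_moment0_tail N M)) // -TE.
by apply: nondecreasing_cvgn_le => //; apply: nondecreasing_series => n _ _; apply: cabs_ge0.
Qed.

(** The products [qprod q N] are bounded by B, so their inverses cannot tend to 0: one of modulus
    below 1/B would give a product of modulus below 1 instead of 1. *)
Lemma csum_moment0_neq0 : csum (qterm q (moment 0)) != 0.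
Proof.
have [B HB] := prod_1D_bound (cabs_ge0 q) q1.
have qB N : cabs (qprod q N) <= B.
  apply: le_trans (HB N); rewrite /qprod.
  elim: N => [|N IH]; first by rewrite !big_ord0 cabs1.
  rewrite !big_ord_recr /= cabsM ler_pM ?cabs_ge0 //.
  by rewrite (le_trans (cabsD _ _)) // cabsN cabsX cabs1.
have B0 : 0 < B.
  by apply: lt_le_trans (HB 0%N); rewrite big_ord0.
apply/eqP => c0; have := inv_qprod_cvg; rewrite c0 => /cvgrPdist_lt /(_ (B^-1)%:C).
have B0' : 0 < (B^-1)%:C :> R[i] by rewrite ltcR invr_gt0.
move=> /(_ B0') /filter_ex[N]; rewrite sub0r normrN cabsE ltcR => lt.
have : cabs (qprod q N * (qprod q N)^-1) < 1.
  rewrite cabsM -(mulfV (lt0r_neq0 B0)) (le_lt_trans (y := B * cabs (qprod q N)^-1)) //.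
    by rewrite ler_wpM2r ?cabs_ge0.
  by rewrite ltr_pM2l.
by rewrite mulfV ?qprod_neq0 // cabs1 ltxx.
Qed.

Lemma qpoch_moment0 : qpoch q q * csum (qterm q (moment 0)) = 1.
Proof.
suff -> : qpoch q q = (csum (qterm q (moment 0)))^-1 by rewrite mulVf ?csum_moment0_neq0.
have : (fun N => \prod_(0 <= n < N) (1 - q * q ^+ n) : R[i]^o) @ \oo -->
    ((csum (qterm q (moment 0)))^-1 : R[i]^o).
  have := cvgV csum_moment0_neq0 inv_qprod_cvg.
  rewrite (_ : (fun N => \prod_(0 <= n < N) _) = (fun N => ((qprod q N)^-1)^-1 : R[i]^o)).
    by apply.
  apply: funext => N; rewrite invrK big_mkord; apply: eq_bigr => j _.
  by rewrite -exprS.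
by move=> h; rewrite /qpoch /cprod (cvg_lim _ h).
Qed.

(** There are at most n divisors, each contributing at most n^k. *)
Lemma sigma0_bound (k n : nat) : (0 <= sigma0 k n <= n%:Z ^+ k.+1).
Proof.
case: n => [|n] /=; first by rewrite expr0n.
have -> : n.+1%:Z ^+ k.+1 = (n.+1 ^ k.+1)%N%:Z by rewrite -[RHS]natz natrX natz.
rewrite lez_nat /sigma expnS.
apply: (@leq_trans (\sum_(d <- divisors n.+1) n.+1 ^ k)).
  rewrite big_seq_cond [leqRHS]big_seq_cond; apply: leq_sum => d /andP[dn _].
  case: k => // k; rewrite leq_exp2r //; apply: dvdn_leq => //; by rewrite dvdn_divisors.
rewrite big_const_seq count_predT iter_addn_0 mulnC leq_mul2r; apply/orP; right.
have : {subset divisors n.+1 <= iota 1 n.+1}.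
  move=> d; rewrite -dvdn_divisors // mem_iota => dn.
  by rewrite (dvdn_gt0 _ dn) // add1n ltnS dvdn_leq.
by move/(uniq_leq_size (divisors_uniq _)); rewrite size_iota.
Qed.

Lemma abs_summable_sigma (k : nat) : abs_summable (qterm q (sigma0 k)).
Proof.
have [B HB] := power_geometric_sum_bound k.+1 (cabs_ge0 q) q1; exists B => N.
apply: le_trans (HB N); apply: ler_sum => n _; have /andP[s0 s1] := sigma0_bound k n.
rewrite cabs_qterm // ler_wpM2r ?exprn_ge0 ?cabs_ge0 //.
have -> : n%:R ^+ k.+1 = (n%:Z ^+ k.+1)%:~R :> R by rewrite rmorphXn.
by rewrite ler_int.
Qed.

Lemma csum_sigma (k : nat) :
  csum (fun n => (sigma k n.+1)%:R * q ^+ n.+1) = csum (qterm q (sigma0 k)).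
Proof.
apply: csum_eq; have := abs_summable_cvg (abs_summable_sigma k).
rewrite -(cvg_shiftn 1) /= (_ : (fun N => \sum_(n < N + 1) _) =
   (fun N => \sum_(n < N) (sigma k n.+1)%:R * q ^+ n.+1)) //.
apply: funext => N; rewrite addn1 big_ord_recl /= /qterm /= mul0r add0r.
by apply: eq_bigr => n _; rewrite /= -pmulrn.
Qed.

Lemma moment_qterm_rec (K : nat) : qterm q (moment (2 * K.+1)) =
  (fun n => 2 * \sum_(t < K.+1) 'C((2 * K).+1, (2 * t).+1)%:R *
    cauchy_prod (qterm q (sigma0 (2 * t).+1)) (qterm q (moment (2 * (K - t)))) n).
Proof.
apply: funext => n; rewrite /qterm moment_rec rmorphM rmorph_sum -mulrA mulr_suml /=.
congr (_ * _); apply: eq_bigr => t _; rewrite rmorphM /= -mulrA; congr (_ * _).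
  by rewrite rmorph_nat.
rewrite cauchy_prod_exp; congr (_ * _).
by rewrite rmorph_sum; apply: eq_bigr => s _; rewrite rmorphM.
Qed.

Lemma abs_summableZ (c : R[i]) (u : nat -> R[i]) :
  abs_summable u -> abs_summable (fun n => c * u n).
Proof.
move=> [B HB]; exists (cabs c * B) => N; under eq_bigr do rewrite cabsM.
by rewrite -mulr_sumr ler_wpM2l ?cabs_ge0.
Qed.

Lemma abs_summable_sum (I : Type) (s : seq I) (u : I -> nat -> R[i]) :
  (forall i, abs_summable (u i)) -> abs_summable (fun n => \sum_(i <- s) u i n).
Proof.
move=> su; elim: s => [|i s [B HB]].
  exists 0 => N; rewrite big1 // => n _; by rewrite big_nil cabs0.
have [A HA] := su i; exists (A + B) => N.
apply: le_trans (lerD (HA N) (HB N)); rewrite -big_split; apply: ler_sum => n _ /=.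
by rewrite big_cons cabsD.
Qed.

Lemma csumZ (c : R[i]) (u : nat -> R[i]) : abs_summable u ->
  csum (fun n => c * u n) = c * csum u.
Proof.
move=> /abs_summable_cvg uc; apply: csum_eq.
rewrite (_ : (fun N => _) = (fun N => c * \sum_(n < N) u n : R[i]^o)).
  exact: (cvgM (cvg_cst _) uc).
by apply: funext => N; rewrite mulr_sumr.
Qed.

Lemma csum_sum (I : Type) (s : seq I) (u : I -> nat -> R[i]) :
  (forall i, abs_summable (u i)) ->
  csum (fun n => \sum_(i <- s) u i n) = \sum_(i <- s) csum (u i).
Proof.
move=> su; elim: s => [|i s IH].
  apply: csum_eq; rewrite (_ : (fun N => _) = (fun N => 0 : R[i]^o)).
    by rewrite big_nil; apply: cvg_cst.
  by apply: funext => N; rewrite big1 // => n _; rewrite big_nil.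
rewrite big_cons -IH; apply: csum_eq.
rewrite (_ : (fun N => _) = (fun N => \sum_(n < N) u i n +
    \sum_(n < N) \sum_(i <- s) u i n : R[i]^o)).
  exact: (cvgD (abs_summable_cvg (su i)) (abs_summable_cvg (abs_summable_sum s su))).
by apply: funext => N; rewrite -big_split; apply: eq_bigr => n _; rewrite big_cons.
Qed.

(** Strong induction through the recurrence: summability is inherited from [moment 0] and the
    divisor series, without a growth estimate on M(m, n). *)
Lemma abs_summable_moment (K : nat) : abs_summable (qterm q (moment (2 * K))).
Proof.
elim/ltn_ind: K => -[|K] IH; first exact: abs_summable_moment0.
rewrite moment_qterm_rec; apply: abs_summableZ; apply: abs_summable_sum => t.
apply: abs_summableZ; apply: abs_summable_cauchy_prod; first exact: abs_summable_sigma.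
by apply: IH; rewrite ltnS leq_subr.
Qed.

Lemma csum_moment_rec (K : nat) : csum (qterm q (moment (2 * K.+1))) =
  2 * \sum_(t < K.+1) 'C((2 * K).+1, (2 * t).+1)%:R *
    csum (qterm q (sigma0 (2 * t).+1)) * csum (qterm q (moment (2 * (K - t)))).
Proof.
have sc t : abs_summable (cauchy_prod
    (qterm q (sigma0 (2 * t).+1)) (qterm q (moment (2 * (K - t))))).
  by apply: abs_summable_cauchy_prod; [apply: abs_summable_sigma|apply: abs_summable_moment].
rewrite moment_qterm_rec csumZ; last by apply: abs_summable_sum => t; apply: abs_summableZ.
rewrite csum_sum => [|t]; last exact: abs_summableZ.
congr (_ * _); apply: eq_bigr => t _; rewrite csumZ // csum_cauchy_prod ?mulrA //.
  exact: abs_summable_sigma.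
exact: abs_summable_moment.
Qed.

Lemma norm_crank_momentE (k : nat) :
  norm_crank_moment k q = qpoch q q * csum (qterm q (moment k)).
Proof. by []. Qed.

Lemma norm_crank_moment0 : norm_crank_moment 0 q = 1.
Proof. by rewrite norm_crank_momentE qpoch_moment0. Qed.

Lemma norm_crank_moment_rec (K : nat) : norm_crank_moment (2 * K.+1) q =
  2 * \sum_(t < K.+1) 'C((2 * K).+1, (2 * t).+1)%:R *
    csum (qterm q (sigma0 (2 * t).+1)) * norm_crank_moment (2 * (K - t)) q.
Proof.
rewrite norm_crank_momentE csum_moment_rec mulrCA; congr (_ * _); rewrite mulr_sumr.
by apply: eq_bigr => t _; rewrite norm_crank_momentE mulrCA.
Qed.

End CrankMoments.

(** * Partition traces *)

Section Traces.
Variable F : numFieldType.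
Implicit Types (a y : nat -> F) (c : nat -> F).

Lemma fact_neq0 (n : nat) : n`!%:R != 0 :> F.
Proof. by rewrite pnatr_eq0 -lt0n fact_gt0. Qed.

(** Divided powers: differentiation lowers the index by one with no numerical factor, and the
    addition formula has no binomials. *)
Definition expterm (p : {poly F}) (l : nat) : {poly F} := (l`!%:R)^-1 *: p ^+ l.

Lemma deriv_expterm0 (p : {poly F}) : (expterm p 0)^`() = 0.
Proof. by rewrite /expterm expr0 derivZ -polyC1 derivC scaler0. Qed.

Lemma deriv_exptermS (p : {poly F}) (l : nat) :
  (expterm p l.+1)^`() = p^`() * expterm p l.
Proof.
rewrite /expterm derivZ deriv_exp /= -scalerAr -scaler_nat scalerA; congr (_ *: _).
by rewrite factS natrM invfM mulrAC mulVf ?mul1r // pnatr_eq0.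
Qed.

Lemma exptermD (p r : {poly F}) (l : nat) :
  expterm (p + r) l = \sum_(j < l.+1) expterm p j * expterm r (l - j).
Proof.
rewrite /expterm addrC exprDn scaler_sumr; apply: eq_bigr => j _.
rewrite -scalerAl -scalerAr scalerA [r ^+ _ * _]mulrC -scaler_nat scalerA; congr (_ *: _).
have jl : (j <= l)%N by rewrite -ltnS.
have E := bin_fact jl; apply: (mulfI (fact_neq0 l)); rewrite mulrA mulfV ?fact_neq0 // mul1r.
by rewrite -[in RHS]E !natrM; field; rewrite !fact_neq0.
Qed.

(* In the product of the truncated series exp(x_i T) = sum_j expterm (x_i) j T^j,
   the coefficient of T^l is expterm (sum_i x_i) l by [exptermD]. *)
Lemma multinomial (k L l : nat) (x : 'I_k -> {poly F}) : (l <= L)%N ->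
  expterm (\sum_(i < k) x i) l =
  \sum_(m : {ffun 'I_k -> 'I_L.+1} | (\sum_(i < k) m i == l)%N) \prod_(i < k) expterm (x i) (m i).
Proof.
pose E (p : {poly F}) : {poly {poly F}} := \poly_(j < L.+1) expterm p j.
have prodE (s : seq 'I_k) j : (j <= L)%N ->
    (\prod_(i <- s) E (x i))`_j = expterm (\sum_(i <- s) x i) j.
  elim: s j => [|i s IH] j jL.
    rewrite !big_nil coef1 /expterm; case: j {jL} => [|j] /=;
      by rewrite ?expr0 ?invr1 ?scale1r // expr0n scaler0.
  rewrite !big_cons coefM exptermD; apply: eq_bigr => h _.
  have hj : (h <= j)%N by rewrite -ltnS.
  by rewrite coef_poly ltnS (leq_trans hj jL) IH // (leq_trans (leq_subr _ _)).
move=> lL; rewrite -(prodE (index_enum 'I_k)) // /E.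
under eq_bigr do rewrite poly_def.
rewrite bigA_distr_bigA /= coef_sum [RHS]big_mkcond; apply: eq_bigr => m _.
rewrite scaler_prod -expr_sum coefZ coefXn eq_sym.
by case: ifP => _; rewrite ?mulr1 ?mulr0.
Qed.

(** The series sum_(j >= 1) y_j X^j cut at degree k. The explicit factor X shows that its n-th power
    starts in degree n. *)
Definition gpoly (k : nat) y : {poly F} := (\poly_(i < k) y i.+1) * 'X.

Lemma coef_gpoly (k : nat) y (j : nat) :
  (gpoly k y)`_j = if (0 < j <= k)%N then y j else 0.
Proof. by rewrite coefMX coef_poly; case: j. Qed.

Lemma coef_mul_gpolyX (k : nat) y (p : {poly F}) (n j : nat) : (j < n)%N ->
  (p * gpoly k y ^+ n)`_j = 0.
Proof. by move=> jn; rewrite exprMn_comm ?mulrA ?coefMXn ?jn //; apply: commr_polyX. Qed.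

(** The coefficient of X^k in the l-th divided power collects the partitions of k with l parts. The
    weight [c] of the length selects the series: c = 1 gives exp, and c_l = (-1)^(l-1) (l-1)! gives
    log. *)
Lemma trace_coef (k : nat) c y :
  \sum_(m : {ffun 'I_k -> 'I_k.+1} | is_partition m)
     c (part_length m) * \prod_(i < k) (y i.+1 ^+ m i / (m i)`!%:R) =
  \sum_(l < k.+1) c l * (expterm (gpoly k y) l)`_k.
Proof.
have gE : gpoly k y = \sum_(i < k) y i.+1 *: 'X^(i.+1).
  rewrite /gpoly poly_def mulr_suml; apply: eq_bigr => i _.
  by rewrite -scalerAl exprSr.
have prod_coef (m : {ffun 'I_k -> 'I_k.+1}) :
    (\prod_(i < k) expterm (y i.+1 *: 'X^(i.+1)) (m i))`_k =
    if is_partition m then \prod_(i < k) (y i.+1 ^+ m i / (m i)`!%:R) else 0.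
  rewrite /expterm; under eq_bigr do rewrite exprZn scalerA -exprM.
  rewrite scaler_prod -expr_sum coefZ coefXn eq_sym /is_partition.
  case: ifP => _; rewrite ?mulr1 ?mulr0 //.
  by apply: eq_bigr => i _; rewrite mulrC.
transitivity (\sum_(l < k.+1) \sum_(m : {ffun 'I_k -> 'I_k.+1} |
     is_partition m && (part_length m == l))
     c l * \prod_(i < k) (y i.+1 ^+ m i / (m i)`!%:R)); last first.
  apply: eq_bigr => l _; rewrite gE (@multinomial _ k); last by rewrite -ltnS.
  rewrite coef_sum mulr_sumr big_mkcondl; apply: eq_bigr => m _.
  by rewrite prod_coef; case: ifP; rewrite ?mulr0.
rewrite (exchange_big_dep (@is_partition k)) /= => [|l m _ /andP[]//].
apply: eq_bigr => m mP.
have mk : (part_length m < k.+1)%N.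
  rewrite ltnS -[leqRHS](eqP mP) /part_length; apply: leq_sum => i _.
  by rewrite leq_pmull.
by rewrite (big_pred1 (Ordinal mk)) // => l; rewrite mP /= eq_sym.
Qed.

Section Recurrence.
Variables (a y : nat -> F).
Hypothesis a0 : a 0%N = 1.
Hypothesis a_rec : forall K, K.+1%:R * a K.+1 =
  \sum_(t < K.+1) t.+1%:R * y t.+1 * a (K - t)%N.

Lemma exp_trace (k : nat) :
  \sum_(l < k.+1) (expterm (gpoly k y) l)`_k = a k.
Proof.
pose E := \sum_(l < k.+1) expterm (gpoly k y) l.
rewrite -coef_sum -/E.
(* E is exp u truncated at degree k in u, hence E' = u' E up to a term of
   valuation at least k. *)
have dE : E^`() = (gpoly k y)^`() * (E - expterm (gpoly k y) k).
  rewrite /E [in RHS]big_ord_recr addrK mulr_sumr big_ord_recl derivD /=.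
  rewrite deriv_expterm0 add0r (raddf_sum (@deriv F)).
  by apply: eq_bigr => l _; apply: deriv_exptermS.
have coefE K : (K < k)%N -> K.+1%:R * E`_K.+1 = \sum_(t < K.+1) t.+1%:R * y t.+1 * E`_(K - t).
  move=> Kk; have := congr1 (fun p : {poly F} => p`_K) dE.
  rewrite coef_deriv mulrBr coefB /expterm -scalerAr coefZ coef_mul_gpolyX // mulr0 subr0.
  rewrite coefM mulr_natl => ->; apply: eq_bigr => t _.
  by rewrite coef_deriv coef_gpoly /= (leq_trans (ltn_ord t) Kk) mulr_natl.
suff : forall j, (j <= k)%N -> E`_j = a j by apply.
elim/ltn_ind => -[_ _|K IH Kk].
  rewrite a0 /E big_ord_recl coefD /expterm expr0 invr1 scale1r coef1 coef_sum.
  rewrite big1 ?addr0 //= => l _.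
  by rewrite coefZ -[_ ^+ _]mul1r coef_mul_gpolyX // mulr0.
apply: (mulfI (_ : K.+1%:R != 0)); rewrite ?pnatr_eq0 // coefE // a_rec.
by apply: eq_bigr => t _; rewrite IH //; lia.
Qed.

(** The weights divided by l! are the logarithm coefficients (-1)^(l-1) / l. At l = 0 the truncated
    predecessor gives weight 1, a constant term that the coefficient at k > 0 does not see. *)
Lemma log_trace (k : nat) : (0 < k)%N ->
  \sum_(l < k.+1) (-1) ^+ l.-1 * l.-1`!%:R * (expterm (gpoly k a) l)`_k = y k.
Proof.
move=> k0; pose v := gpoly k a.
pose L := \sum_(l < k.+1) ((-1) ^+ l.-1 * l.-1`!%:R) *: expterm v l.
transitivity (L`_k).
  by rewrite coef_sum; apply: eq_bigr => l _; rewrite [RHS]coefZ.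
(* L is 1 + log (1 + v) truncated: (1 + v) L' = v' modulo 'X^k. *)
have dL : (1 + v) * L^`() = v^`() * (1 - (- v) ^+ k).
  have -> : L^`() = v^`() * \sum_(l < k) (- v) ^+ l.
    rewrite /L big_ord_recl derivD mulr_sumr.
    rewrite derivZ deriv_expterm0 scaler0 add0r (raddf_sum (@deriv F)).
    apply: eq_bigr => l _; rewrite [LHS]derivZ deriv_exptermS /expterm /= scalerAr scalerA.
    rewrite -(scaleN1r v) exprZn; congr (_ * (_ *: _)).
    by rewrite mulfK ?fact_neq0.
  rewrite mulrCA; congr (_ * _); apply: oppr_inj.
  by rewrite opprB subrX1 -mulNr; congr (_ * _); rewrite opprD addrC.
have coefL K : (K < k)%N -> \sum_(t < K.+1) t.+1%:R * L`_t.+1 * a (K - t)%N = K.+1%:R * a K.+1.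
  move=> Kk; have := congr1 (fun p : {poly F} => p`_K) dL.
  rewrite mulrBr mulr1 coefB exprNn mulrA coef_mul_gpolyX // subr0 coef_deriv coef_gpoly /= Kk.
  rewrite mulr_natl => <-; rewrite mulrC coefM; apply: eq_bigr => t _.
  rewrite coef_deriv -[L`_t.+1 *+ _]mulr_natl coefD coef1 coef_gpoly; congr (_ * _).
  have := leq_subr t K; case: (K - t)%N => [_|n nK] /=; first by rewrite addr0 a0.
  by rewrite add0r (leq_trans nK (ltnW Kk)).
suff : forall t, (t < k)%N -> L`_t.+1 = y t.+1.
  by case: k k0 v L dL coefL => // k _ v L _ _; apply.
(* The two expressions for (K+1) a_(K+1) agree for t < K by induction; since a_0 = 1, the last terms
   yield the new coefficient. *)
elim/ltn_ind => K IH Kk; have := coefL K Kk.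
rewrite a_rec !big_ord_recr /= subnn a0 !mulr1.
rewrite (eq_bigr (fun t : 'I_K => t.+1%:R * y t.+1 * a (K - t)%N)) => [/addrI|t _].
  by apply: mulfI; rewrite pnatr_eq0.
by rewrite IH // (ltn_trans _ Kk).
Qed.

End Recurrence.

End Traces.

(** * Specialization to the crank moments and the Eisenstein series *)

Lemma partition_trace_M (F : numFieldType) (k : nat) (X : nat -> F) :
  partition_trace (@phi_M F k) X =
  (2 * k)`!%:R * \sum_(l < k.+1) (expterm (gpoly k (fun j => 2 * X j / (2 * j)`!%:R)) l)`_k.
Proof.
have := trace_coef k (fun _ => 1) (fun j => 2 * X j / (2 * j)`!%:R).
under [X in _ = X -> _]eq_bigr do rewrite mul1r; move=> <-.
rewrite mulr_sumr; apply: eq_bigr => m _; rewrite mul1r /phi_M -mulrA; congr (_ * _).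
rewrite -big_split; apply: eq_bigr => i _ /=.
by rewrite !exprMn exprVn invfM; ring.
Qed.

Lemma partition_trace_S (F : numFieldType) (k : nat) (X : nat -> F) :
  partition_trace (@phi_S F k) X =
  (2 * k)`!%:R / 2 * \sum_(l < k.+1) (-1) ^+ l.-1 * l.-1`!%:R *
    (expterm (gpoly k (fun j => X j / (2 * j)`!%:R)) l)`_k.
Proof.
have <- := trace_coef k (fun l => (-1) ^+ l.-1 * l.-1`!%:R) (fun j => X j / (2 * j)`!%:R).
rewrite mulr_sumr; apply: eq_bigr => m _; rewrite /phi_S -!mulrA; do 4 congr (_ * _).
rewrite -big_split; apply: eq_bigr => i _ /=.
by rewrite !exprMn exprVn invfM; ring.
Qed.

(** The Bernoulli terms cancel as 2 (2j) = 4j. The cancellation is formal and covers j = 0, so it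
    yields an equality of functions of j. *)
Lemma eisensteinE (R : realType) (tau : R[i]) (j : nat) : 0 < complex.Im tau ->
  eisenstein (2 * j) tau + ratr (bernoulli (2 * j)) / (4 * j)%:R =
  csum (qterm (nome tau) (sigma0 (2 * j).-1)).
Proof.
move=> htau; rewrite /eisenstein mulnA addrAC mulNr addNr add0r.
by rewrite csum_sigma // cabs_nome_lt1.
Qed.

Definition scaled_moment (R : realType) (q : R[i]) (j : nat) : R[i] :=
  norm_crank_moment (2 * j) q / (2 * j)`!%:R.

Definition scaled_sigma (R : realType) (q : R[i]) (j : nat) : R[i] :=
  2 * csum (qterm q (sigma0 (2 * j).-1)) / (2 * j)`!%:R.

Lemma scaled_moment0 (R : realType) (q : R[i]) : cabs q < 1 -> scaled_moment q 0 = 1.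
Proof. by move=> q1; rewrite /scaled_moment norm_crank_moment0 // invr1 mulr1. Qed.

(** Since (2t+2)! = 2 (t+1) (2t+1)!, and likewise for K, division by the factorials turns the
    binomial weights into the plain convolution a' = y' a. *)
Lemma scaled_moment_rec (R : realType) (q : R[i]) (K : nat) : cabs q < 1 ->
  K.+1%:R * scaled_moment q K.+1 =
  \sum_(t < K.+1) t.+1%:R * scaled_sigma q t.+1 * scaled_moment q (K - t)%N.
Proof.
move=> q1; rewrite /scaled_moment norm_crank_moment_rec // !mulr_sumr mulr_suml mulr_sumr.
apply: eq_bigr => t _; rewrite /scaled_sigma.
have tK : (t <= K)%N by rewrite -ltnS.
have -> : (2 * t.+1).-1 = (2 * t).+1 by lia.
have -> : (2 * t.+1 = (2 * t).+2)%N by lia.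
have -> : (2 * K.+1 = (2 * K).+2)%N by lia.
have /bin_fact : ((2 * t).+1 <= (2 * K).+1)%N by lia.
have -> : ((2 * K).+1 - (2 * t).+1 = 2 * (K - t))%N by lia.
move: (csum _) (norm_crank_moment _ _) => s n.
rewrite !(factS (2 * _).+1) => /(congr1 (fun x => x%:R : R[i])).
rewrite !natrM => <-.
have -> : (2 * t).+2%:R = 2 * t.+1%:R :> R[i] by rewrite -natrM; congr _%:R; lia.
have -> : (2 * K).+2%:R = 2 * K.+1%:R :> R[i] by rewrite -natrM; congr _%:R; lia.
have C0 : 'C((2 * K).+1, (2 * t).+1)%:R != 0 :> R[i].
  by rewrite pnatr_eq0 -lt0n bin_gt0; lia.
field.
by rewrite C0 !fact_neq0 -natrM !nat1r !pnatr_eq0.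
Qed.

Theorem corollary4p1 (R : realType) (tau : R[i]) (htau : 0 < complex.Im tau)
    (k : nat) (hk : (1 <= k)%N) :
  norm_crank_moment (2 * k) (nome tau) =
    partition_trace (@phi_M R[i] k)
      (fun j => eisenstein (2 * j) tau + ratr (bernoulli (2 * j)) / (4 * j)%:R)
  /\
  eisenstein (2 * k) tau =
    - ratr (bernoulli (2 * k)) / (4 * k)%:R
    + partition_trace (@phi_S R[i] k)
        (fun j => norm_crank_moment (2 * j) (nome tau)).
Proof.
have q1 := cabs_nome_lt1 htau.
have a0 := scaled_moment0 q1; have a_rec K := scaled_moment_rec K q1.
rewrite partition_trace_M partition_trace_S; split.
  have -> : (fun j => 2 * (eisenstein (2 * j) tau + ratr (bernoulli (2 * j)) / (4 * j)%:R) /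
      (2 * j)`!%:R) = scaled_sigma (nome tau).
    by apply: funext => j; rewrite eisensteinE.
  by rewrite (exp_trace a0 a_rec) mulrCA mulfV ?mulr1 ?fact_neq0.
rewrite (log_trace a0 a_rec) // /scaled_sigma -eisensteinE //.
have -> : (2 * k)`!%:R / 2 * (2 * (eisenstein (2 * k) tau + ratr (bernoulli (2 * k)) / (4 * k)%:R) /
    (2 * k)`!%:R) = eisenstein (2 * k) tau + ratr (bernoulli (2 * k)) / (4 * k)%:R.
  by field; rewrite fact_neq0 pnatr_eq0; lia.
by rewrite mulNr addrCA addNr addr0.
Qed.
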